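(* Let $f$ be a function defined on the interval $[a,b]$, integrable on $[a,b]$ and having a primitive $F$ on $[a,b]$. For any integer $n\ge 1$, $$\int_{a}^{b}f(x_n)\int_{a}^{x_n}f(x_{n-1})\cdots\int_{a}^{x_2}f(x_1)\,dx_1\cdots dx_n=\frac{1}{n!}\left(\int_a^bf(x)\,dx\right)^n=\frac{\bigl(F(b)-F(a)\bigr)^n}{n!}.$$
   Context: The left-hand side is the $n$-th order definite recurrent integral of $f$: $x_i$ is integrated from $a$ to $x_{i+1}$ for $i<n$, and $x_n$ from $a$ to $b$. $F$ is a primitive of $f$: $F'=f$ on $[a,b]$. *)

(* Defs.v *)
From Stdlib Require Import Arith Reals.
From Coquelicot Require Import Coquelicot.
Open Scope R_scope.

(* D_in differentiates relative to the interval, so the derivatives at the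
   endpoints are one-sided and F is unconstrained outside [a, b]. *)
Definition is_primitive_on (a b : R) (f F : R -> R) : Prop :=
  forall x, a <= x <= b -> D_in F f (fun y => a <= y <= b) x.

(* [recurrent_integral f a n x] is
   int_a^x f(x_n) int_a^{x_n} f(x_{n-1}) ... int_a^{x_2} f(x_1) dx_1 ... dx_n,
   the empty integral being 1. *)
Fixpoint recurrent_integral (f : R -> R) (a : R) (n : nat) (x : R) : R :=
  match n with
  | O => 1
  | S k => RInt (fun t => f t * recurrent_integral f a k t) a x
  end.

(* RInt is total: this says that the n nested Riemann integrals defining
   [recurrent_integral f a n b] exist for all values of the outer variables. *)
Definition ex_recurrent_integral (f : R -> R) (a b : R) (n : nat) : Prop :=
  forall (k : nat) (x : R), (k < n)%nat -> a <= x <= b ->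
    ex_RInt (fun t => f t * recurrent_integral f a k t) a x.

(* Main.v *)
Require Import Defs.
From Stdlib Require Import Arith Reals Lra Lia ClassicalEpsilon.
From Coquelicot Require Import Coquelicot.
Open Scope R_scope.

(** [f] is only Riemann integrable, so [RInt f a] need not be differentiable,
    and the fundamental theorem is used in its strong form: if [H' = h] and
    [h] is integrable, the mean value theorem lets one tag any subdivision so
    that its Riemann sum telescopes to [H b - H a].  With [G = F - F a] the
    [k]-fold integral up to [x] is then [G x ^ k / k!] by induction, as
    [G ^ (k+1) / (k+1)!] has derivative [f * G ^ k / k!], which is integrable
    as a product of an integrable and a continuous function. *)

(** * Riemann sums and the strong fundamental theorem of calculus *)

Lemma seq_step_cons (x y : R) (l : list R) :
  seq_step (x :: y :: l) = Rmax (Rabs (y - x)) (seq_step (y :: l)).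
Proof. reflexivity. Qed.

Lemma SF_lx_head {T : Type} (s : @SF_seq T) :
  SF_lx s = (SF_h s :: seq.unzip1 (SF_t s))%list.
Proof. reflexivity. Qed.

Lemma pointed_subdiv_cons (x t : R) (s : @SF_seq R) :
  x <= t <= SF_h s -> pointed_subdiv s -> pointed_subdiv (SF_cons (x, t) s).
Proof.
  intros Ht Hs [|i] Hi.
  - exact Ht.
  - rewrite SF_size_cons in Hi.
    exact (Hs i (proj2 (Nat.succ_lt_mono _ _) Hi)).
Qed.

Lemma length_le_nat_mul (l d : R) : 0 < d -> exists n : nat, l <= INR n * d.
Proof.
  intros Hd.
  destruct (INR_unbounded (l / d)) as [n Hn].
  exists n.
  apply Rlt_le.
  replace l with (l / d * d) by (field; lra).
  apply Rmult_lt_compat_r; lra.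
Qed.

(** On each piece [[c, m]] the mean value theorem supplies a tag [t] with
    [h t * (m - c) = H m - H c]. These increments of [H] add up to the total increment. *)
Lemma telescoping_subdivision (h H : R -> R) (a b d : R) :
  0 < d ->
  (forall x, a <= x <= b -> continuity_pt H x) ->
  (forall x, a < x < b -> is_derive H x (h x)) ->
  a <= b ->
  exists s : @SF_seq R,
    pointed_subdiv s /\ SF_h s = a /\ seq.last (SF_h s) (SF_lx s) = b /\
    seq_step (SF_lx s) <= d /\ Riemann_sum h s = H b - H a.
Proof.
  intros Hd Hc HD Hab.
  (* The left end [c] varies, so that the induction on the number of pieces can put one piece in
     front of a subdivision of the rest. *)
  assert (Hind : forall (n : nat) (c : R), a <= c <= b -> b - c <= INR n * d ->
    exists s : @SF_seq R,
      pointed_subdiv s /\ SF_h s = c /\ seq.last (SF_h s) (SF_lx s) = b /\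
      seq_step (SF_lx s) <= d /\ Riemann_sum h s = H b - H c).
  { induction n as [|n IH]; intros c Hcab Hn.
    - simpl in Hn.
      assert (c = b) by lra. subst c.
      exists (SF_nil b).
      repeat split.
      + unfold SF_size, SF_nil in *; simpl in *; lia.
      + unfold SF_size, SF_nil in *; simpl in *; lia.
      + unfold seq_step; simpl; lra.
      + unfold Riemann_sum; simpl. unfold zero; simpl. ring.
    - rewrite S_INR in Hn.
      (* The next node lies one step of length [d] to the right, cut off at [b]. *)
      set (m := Rmin (c + d) b).
      assert (Hm : c <= m <= b /\ m <= c + d /\ b - m <= INR n * d).
      { pose proof (pos_INR n).
        assert (0 <= INR n * d) by (apply Rmult_le_pos; lra).
        unfold m, Rmin. destruct (Rle_dec (c + d) b); lra. }
      destruct (IH m) as (s & Hs & Hh & Hl & Hst & HR); try lra.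
      destruct (MVT_gen H c m h) as (t & Ht & HMVT).
      + intros x Hx. rewrite Rmin_left, Rmax_right in Hx by lra. apply HD; lra.
      + intros x Hx. rewrite Rmin_left, Rmax_right in Hx by lra. apply Hc; lra.
      + rewrite Rmin_left, Rmax_right in Ht by lra.
        exists (SF_cons (c, t) s).
        split; [|split; [|split; [|split]]].
        * apply pointed_subdiv_cons; [rewrite Hh; lra | exact Hs].
        * reflexivity.
        * rewrite <- Hl. reflexivity.
        * rewrite SF_lx_cons, SF_lx_head, seq_step_cons, <- SF_lx_head, Hh.
          apply Rmax_lub; [|exact Hst].
          simpl. rewrite Rabs_pos_eq; lra.
        * rewrite Riemann_sum_cons, HR, Hh.
          unfold plus, scal; simpl. unfold mult; simpl. lra. }
  destruct (length_le_nat_mul (b - a) d Hd) as [n Hn].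
  apply (Hind n a); lra.
Qed.

(** Every fine enough Riemann sum is near the integral [I], and some arbitrarily fine one equals
    [H b - H a]. Were the two numbers distinct, taking their distance as the tolerance would make
    that distance less than itself. *)
Lemma is_RInt_derive_integrable (h H : R -> R) (a b : R) :
  a <= b ->
  (forall x, a <= x <= b -> continuity_pt H x) ->
  (forall x, a < x < b -> is_derive H x (h x)) ->
  ex_RInt h a b ->
  is_RInt h a b (H b - H a).
Proof.
  intros Hab Hc HD [I HI].
  destruct (Req_dec a b) as [<-|Hne].
  { rewrite Rminus_diag. exact (is_RInt_point h a). }
  replace (H b - H a) with I; [exact HI|].
  apply Rminus_diag_uniq, NNPP; intros HN.
  assert (He : 0 < Rabs (I - (H b - H a))) by (apply Rabs_pos_lt; exact HN).
  destruct (HI _ (locally_ball I (mkposreal _ He))) as [d Hd].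
  (* Half of [d], because the subdivision has mesh at most the given bound while convergence asks
     for a mesh strictly below [d]. *)
  assert (Hd2 : 0 < d / 2) by (destruct d; simpl; lra).
  destruct (telescoping_subdivision h H a b (d / 2) Hd2 Hc HD Hab)
    as (s & Hs & Hh & Hl & Hst & HR).
  assert (HB : ball I (Rabs (I - (H b - H a)))
                 (scal (sign (b - a)) (Riemann_sum h s))).
  { apply (Hd s).
    - simpl in Hd2. lra.
    - rewrite Rmin_left, Rmax_right by lra. auto. }
  rewrite HR, sign_eq_1 in HB by lra.
  unfold ball, scal in HB; simpl in HB.
  unfold AbsRing_ball, abs, minus, plus, opp, mult in HB; simpl in HB.
  rewrite <- Rabs_Ropp in HB.
  replace (- (1 * (H b - H a) + - I)) with (I - (H b - H a)) in HB by ring.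
  lra.
Qed.

(** * Integrability of an integrable function times a continuous one *)

Lemma ex_RInt_uniform_approx (h : R -> R) (a b : R) :
  a <= b ->
  (forall eps : posreal, exists k : R -> R, ex_RInt k a b /\
     forall x, a <= x <= b -> Rabs (k x - h x) < eps) ->
  ex_RInt h a b.
Proof.
  intros Hab Happ.
  (* Choice selects one approximant per tolerance. The tolerances [1 / (n + 1)] then give a
     uniformly convergent sequence. *)
  assert (Hk : forall eps : posreal, { k : R -> R | ex_RInt k a b /\
     forall x, a <= x <= b -> Rabs (k x - h x) < eps})
    by (intros eps; apply constructive_indefinite_description, Happ).
  pose (e := fun n : nat => mkposreal _ (RinvN_pos n)).
  (* [filterlim_RInt] asks for uniform convergence on all of [R]. *)
  pose (cut := fun (u : R -> R) x =>
    if Rle_dec a x then if Rle_dec x b then u x else 0 else 0).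
  assert (Hcut : forall u x, a <= x <= b -> cut u x = u x).
  { intros u x Hx. unfold cut.
    destruct (Rle_dec a x); destruct (Rle_dec x b); lra. }
  pose (k := fun n => cut (proj1_sig (Hk (e n)))).
  destruct (filterlim_RInt k a b eventually _ (cut h) (fun n => RInt (k n) a b))
    as (I & _ & HI).
  - intros n. apply (RInt_correct (k n)).
    apply ex_RInt_ext with (2 := proj1 (proj2_sig (Hk (e n)))).
    intros x Hx. rewrite Rmin_left, Rmax_right in Hx by lra.
    symmetry; apply Hcut; lra.
  - apply filterlim_locally. intros eps.
    destruct (archimed_cor1 eps (cond_pos eps)) as (N & HN & HN0).
    exists N. intros n Hn x.
    change (Rabs (k n x - cut h x) < eps).
    unfold k, cut.
    destruct (Rle_dec a x); [destruct (Rle_dec x b)|].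
    2,3: rewrite Rminus_diag, Rabs_R0; apply cond_pos.
    eapply Rlt_trans; [apply (proj2_sig (Hk (e n))); lra|].
    eapply Rle_lt_trans; [|exact HN].
    simpl. apply Rinv_le_contravar.
    + apply lt_0_INR; lia.
    + apply le_INR in Hn. lra.
  - exists I. apply is_RInt_ext with (2 := HI).
    intros x Hx. rewrite Rmin_left, Rmax_right in Hx by lra.
    apply Hcut; lra.
Qed.

Lemma ex_RInt_mult_continuous (f g : R -> R) (a b : R) :
  a <= b ->
  ex_RInt f a b ->
  (forall x, a <= x <= b -> continuity_pt g x) ->
  ex_RInt (fun x => f x * g x) a b.
Proof.
  intros Hab Hf Hg.
  destruct (ex_RInt_ub f a b Hf) as [M0 HM0].
  rewrite Rmin_left, Rmax_right in HM0 by lra.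
  (* Adding 1 makes the bound positive, as division by [M] follows. *)
  set (M := Rmax M0 0 + 1).
  assert (HMpos : 0 < M) by (pose proof (Rmax_r M0 0); unfold M; lra).
  assert (HM : forall x, a <= x <= b -> Rabs (f x) <= M).
  { intros x Hx. pose proof (Rmax_l M0 0).
    specialize (HM0 x Hx). unfold norm in HM0; simpl in HM0.
    unfold abs in HM0; simpl in HM0. unfold M; lra. }
  apply ex_RInt_uniform_approx; [exact Hab|]. intros eps.
  assert (HeM : 0 < eps / M) by (apply Rdiv_lt_0_compat; [apply cond_pos|lra]).
  destruct (Heine_cor2 Hg (mkposreal _ HeM)) as [delta Hdelta].
  assert (Hclose : forall c x, a <= c <= b -> a <= x <= b ->
    Rabs (c - x) < delta -> Rabs (f x * g c - f x * g x) < eps).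
  { intros c x Hc Hx Hcx.
    rewrite <- Rmult_minus_distr_l, Rabs_mult.
    apply Rle_lt_trans with (M * Rabs (g c - g x)).
    - apply Rmult_le_compat_r; [apply Rabs_pos | apply HM; exact Hx].
    - replace (pos eps) with (M * (eps / M)) by (field; lra).
      apply Rmult_lt_compat_l; [lra|].
      apply (Hdelta c x); assumption. }
  assert (Hd2 : 0 < delta / 2) by (destruct delta; simpl; lra).
  assert (Hind : forall (n : nat) (c : R), a <= c <= b ->
    b - c <= INR n * (delta / 2) ->
    exists k : R -> R, ex_RInt k c b /\
      forall x, c <= x <= b -> Rabs (k x - f x * g x) < eps).
  { induction n as [|n IH]; intros c Hcab Hn.
    - simpl in Hn. assert (c = b) by lra. subst c.
      exists (fun x => f x * g x). split; [apply ex_RInt_point|].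
      intros x _. rewrite Rminus_diag, Rabs_R0. apply cond_pos.
    - rewrite S_INR in Hn.
      set (m := Rmin (c + delta / 2) b).
      assert (Hm : c <= m <= b /\ m <= c + delta / 2
                   /\ b - m <= INR n * (delta / 2)).
      { pose proof (pos_INR n).
        assert (0 <= INR n * (delta / 2)) by (apply Rmult_le_pos; lra).
        unfold m, Rmin. destruct (Rle_dec (c + delta / 2) b); lra. }
      destruct (IH m) as (k & Hk & Hkx); try lra.
      exists (fun x => if Rlt_dec x m then f x * g c else k x). split.
      + apply ex_RInt_Chasles with m.
        * apply ex_RInt_ext with (fun x => scal (g c) (f x)).
          -- intros x Hx. rewrite Rmin_left, Rmax_right in Hx by lra.
             destruct (Rlt_dec x m); [|lra].
             unfold scal; simpl. unfold mult; simpl. ring.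
          -- apply (ex_RInt_scal (V := R_NormedModule)).
             apply (ex_RInt_Chasles_1 (V := R_CompleteNormedModule)) with b;
               [lra|].
             apply (ex_RInt_Chasles_2 (V := R_CompleteNormedModule)) with a;
               [lra|exact Hf].
        * apply ex_RInt_ext with (2 := Hk).
          intros x Hx. rewrite Rmin_left, Rmax_right in Hx by lra.
          destruct (Rlt_dec x m); [lra|reflexivity].
      + intros x Hx. destruct (Rlt_dec x m).
        * apply Hclose; try lra. rewrite Rabs_left1; lra.
        * apply Hkx; lra. }
  destruct (length_le_nat_mul (b - a) (delta / 2) Hd2) as [n Hn].
  apply (Hind n a); lra.
Qed.

(** The nearest-point projection onto [[a, b]]. Composing [F] with it extends [F] by constants,
    which turns one-sided continuity at the endpoints into the two-sided continuity that the mean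
    value theorem and Heine's theorem ask for. *)
Definition clamp (a b x : R) : R := Rmax a (Rmin b x).

Lemma clamp_id (a b x : R) : a <= x <= b -> clamp a b x = x.
Proof. intros Hx. unfold clamp. rewrite Rmin_right, Rmax_right; lra. Qed.

Lemma clamp_bounds (a b x : R) : a <= b -> a <= clamp a b x <= b.
Proof.
  intros Hab. unfold clamp, Rmax, Rmin.
  destruct (Rle_dec b x); destruct (Rle_dec a _); lra.
Qed.

Lemma clamp_contraction (a b x y : R) :
  Rabs (clamp a b x - clamp a b y) <= Rabs (x - y).
Proof.
  unfold clamp, Rmax, Rmin.
  destruct (Rle_dec b x), (Rle_dec b y);
    repeat destruct (Rle_dec a _);
    unfold Rabs; repeat destruct (Rcase_abs _); lra.
Qed.

Lemma primitive_clamp_continuous (f F : R -> R) (a b x : R) :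
  a <= b -> is_primitive_on a b f F ->
  continuity_pt (fun y => F (clamp a b y)) x.
Proof.
  intros Hab HF.
  assert (Hx := clamp_bounds a b x Hab).
  assert (Hc := cont_deriv _ _ _ _ (HF _ Hx)).
  intros eps Heps.
  destruct (Hc eps Heps) as (alp & Halp & Hlim).
  exists alp. split; [exact Halp|].
  intros y [_ Hy].
  (* The limit in [Hc] excludes the base point, so two points with the same projection are treated
     apart. *)
  destruct (Req_dec (clamp a b y) (clamp a b x)) as [E|E].
  - rewrite E. simpl. unfold Rdist. rewrite Rminus_diag, Rabs_R0. exact Heps.
  - apply Hlim. split; [split; [apply clamp_bounds; exact Hab | congruence]|].
    eapply Rle_lt_trans; [apply clamp_contraction|exact Hy].
Qed.

Lemma primitive_clamp_derive (f F : R -> R) (a b x : R) :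
  is_primitive_on a b f F -> a < x < b ->
  is_derive (fun y => F (clamp a b y)) x (f x).
Proof.
  intros HF Hx.
  apply is_derive_Reals.
  assert (Hx' : a <= x <= b) by lra.
  intros eps Heps.
  destruct (HF x Hx' eps Heps) as (alp & Halp & Hlim).
  (* This radius keeps [x + h] inside [[a, b]], where the projection is the identity. *)
  assert (Hd : 0 < Rmin alp (Rmin (x - a) (b - x)))
    by (repeat apply Rmin_pos; lra).
  exists (mkposreal _ Hd). simpl. intros h Hh0 Hh.
  assert (Hh1 := Rlt_le_trans _ _ _ Hh (Rmin_l _ _)).
  assert (Hh2 := Rlt_le_trans _ _ _ Hh (Rmin_r _ _)).
  assert (Hh3 := Rlt_le_trans _ _ _ Hh2 (Rmin_l _ _)).
  assert (Hh4 := Rlt_le_trans _ _ _ Hh2 (Rmin_r _ _)).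
  apply Rabs_def2 in Hh3. apply Rabs_def2 in Hh4.
  rewrite !clamp_id by lra.
  specialize (Hlim (x + h)).
  simpl in Hlim. unfold Rdist in Hlim.
  replace (x + h - x) with h in Hlim by ring.
  apply Hlim. repeat split; lra.
Qed.

Theorem theorem2p9 (f F : R -> R) (a b : R) (n : nat)
    (hab : a <= b)
    (hf : ex_RInt f a b)
    (hF : is_primitive_on a b f F)
    (hn : (1 <= n)%nat) :
  ex_recurrent_integral f a b n /\
  recurrent_integral f a n b = / INR (fact n) * (RInt f a b) ^ n /\
  / INR (fact n) * (RInt f a b) ^ n = (F b - F a) ^ n / INR (fact n).
Proof.
  set (G := fun y => F (clamp a b y) - F a).
  assert (HGc : forall x, continuity_pt G x).
  { intros x. apply continuity_pt_minus.
    - apply (primitive_clamp_continuous f); assumption.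
    - apply continuity_pt_const. intros ? ?. reflexivity. }
  assert (HGd : forall x, a < x < b -> is_derive G x (f x)).
  { intros x Hx. unfold G.
    replace (f x) with (minus (f x) 0) by (unfold minus, plus, opp; simpl; ring).
    apply (is_derive_minus (V := R_NormedModule)).
    - apply primitive_clamp_derive; assumption.
    - apply (is_derive_const (V := R_NormedModule)). }
  assert (HGa : G a = 0) by (unfold G; rewrite clamp_id; lra).
  assert (HGb : G b = F b - F a) by (unfold G; rewrite clamp_id; lra).
  assert (HGk : forall k x, continuity_pt (fun t => G t ^ k / INR (fact k)) x).
  { intros k x. induction k as [|k _].
    - apply continuity_pt_const. intros ? ?. reflexivity.
    - apply continuity_pt_mult.
      + apply (continuity_pt_comp G (fun y => y ^ S k)); [apply HGc|].
        apply derivable_continuous_pt, derivable_pt_pow.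
      + apply continuity_pt_const. intros ? ?. reflexivity. }
  (* The integration step, stated for the closed form alone: it yields both the value of each nested
     integral and its existence. *)
  assert (Hpow : forall k x, a <= x <= b ->
    is_RInt (fun t => f t * (G t ^ k / INR (fact k))) a x
            (G x ^ S k / INR (fact (S k)))).
  { intros k x Hx.
    (* The term at the lower limit vanishes since [G a = 0] and the exponent is positive. *)
    replace (G x ^ S k / INR (fact (S k)))
      with (G x ^ S k / INR (fact (S k)) - G a ^ S k / INR (fact (S k)))
      by (rewrite HGa; simpl pow; field; apply INR_fact_neq_0).
    apply (is_RInt_derive_integrable _ (fun t => G t ^ S k / INR (fact (S k))));
      [lra | intros; apply HGk | |].
    - intros t Ht.
      assert (HD : is_derive G t (f t)) by (apply HGd; lra).
      replace (f t * (G t ^ k / INR (fact k)))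
        with (scal (INR (S k) * f t * G t ^ k) (/ INR (fact (S k)))).
      + apply (is_derive_scal_l (V := R_NormedModule) (fun t => G t ^ S k)).
        apply (is_derive_pow G (S k) t (f t) HD).
      + unfold scal.
        rewrite fact_simpl, mult_INR. cbn -[INR fact pow].
        field. split; [apply INR_fact_neq_0 | apply not_0_INR; lia].
    - apply ex_RInt_mult_continuous; [lra | | intros; apply HGk].
      apply (ex_RInt_Chasles_1 (V := R_CompleteNormedModule)) with b;
        [lra | exact hf]. }
  assert (Hrec : forall k x, a <= x <= b ->
    recurrent_integral f a k x = G x ^ k / INR (fact k)).
  { induction k as [|k IH]; intros x Hx.
    - simpl. field.
    - apply (is_RInt_unique (V := R_CompleteNormedModule)).
      apply is_RInt_ext with (2 := Hpow k x Hx).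
      intros t Ht. rewrite Rmin_left, Rmax_right in Ht by lra.
      rewrite IH by lra. reflexivity. }
  assert (HI : RInt f a b = F b - F a).
  { rewrite <- HGb, <- (Rminus_0_r (G b)), <- HGa.
    apply (is_RInt_unique (V := R_CompleteNormedModule)).
    apply is_RInt_derive_integrable; auto. }
  split; [|split].
  - intros k x _ Hx. exists (G x ^ S k / INR (fact (S k))).
    apply is_RInt_ext with (2 := Hpow k x Hx).
    intros t Ht. rewrite Rmin_left, Rmax_right in Ht by lra.
    rewrite Hrec by lra. reflexivity.
  - rewrite Hrec, HGb, HI by lra. unfold Rdiv. ring.
  - rewrite HI. unfold Rdiv. ring.
Qed.
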